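(* Let $q=p^r$ be a prime power ($p$ prime), let $M$ be chosen uniformly at random from $\mathrm{SL}(n,\mathbb{F}_q)$, and let $1\le k\le n$. For any elements $a_i\in\mathbb{F}_q$ indexed by the integers $1\le i\le k$ with $p\nmid i$, $$\left|\mathbb{P}_{M\in\mathrm{SL}(n,\mathbb{F}_q)}\big(\forall\,1\le i\le k\text{ with }p\nmid i:\ \mathrm{Tr}(M^i)=a_i\big)-\frac{1}{q^{k-\lfloor k/p\rfloor}}\right|\le\frac{(q-1)(k+1)\,q^{\lfloor k/p\rfloor}}{q^n}.$$
   Context: $\mathrm{SL}(n,\mathbb{F}_q)$ is the group of $n\times n$ matrices over $\mathbb{F}_q$ of determinant $1$, with uniform probability measure. *)

(* Defs.v *)
From HB Require Import structures.
From mathcomp Require Import all_boot all_order all_algebra all_fingroup all_field.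
Set Implicit Arguments. Unset Strict Implicit. Unset Printing Implicit Defensive.
Import Order.TTheory GRing.Theory Num.Theory.
Local Open Scope ring_scope.

Definition SL_set (F : finFieldType) (n : nat) : {set 'M[F]_n} :=
  [set M : 'M[F]_n | \det M == 1].

Definition trace_event (F : finFieldType) (n p k : nat) (a : nat -> F)
  (M : 'M[F]_n) : bool :=
  [forall i : 'I_k.+1, ((0 < (i : nat))%N && ~~ (p %| i)%N) ==> (\tr (M ^+ i) == a i)].

Definition prob_SL_trace (F : finFieldType) (n p k : nat) (a : nat -> F) : rat :=
  (#|[set M in SL_set F n | trace_event p k a M]|)%:R / (#|SL_set F n|)%:R.

(* Main.v *)
(** Write q = #|F| and count the pairs (v, M) with v a row vector and M in the
    conjugation-invariant set T of matrices of SL_n satisfying the trace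
    conditions, according to the dimension m of the cyclic subspace spanned by
    v, v M, v M^2, ...  In a basis that starts with v, v M, ..., v M^(m-1), the
    matrix M is block triangular with a companion matrix and a matrix N of size
    n - m on the diagonal.  Hence the number of pairs is #|GL_n| times the
    average over N in GL_(n-m) of the number of m x m companion matrices with
    prescribed determinant and prescribed traces of powers.  By Newton's
    identities these traces are triangular in the coefficients, so that this
    number is exactly q^(m - 1 - k + floor(k/p)) when m > k, and at most
    q^floor(k/p) when m <= k.  Summing over m gives q^n #|T|: the terms m > k
    form a geometric series that produces the main term, and the k + 1 terms
    m <= k are the error. *)

Require Import Defs.
From HB Require Import structures.
From mathcomp Require Import all_boot all_order all_algebra all_fingroup all_field.
From mathcomp Require Import zify ring lra.
Import Order.TTheory GRing.Theory Num.Theory.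
Local Open Scope ring_scope.
Set Implicit Arguments. Unset Strict Implicit. Unset Printing Implicit Defensive.

(* Companion matrix of X^m - c_0 X^(m-1) - ... - c_(m-1), acting on row vectors. *)
Definition comp_mx (F : fieldType) m (c : 'rV[F]_m) : 'M[F]_m :=
  \matrix_(i, j) if i.+1 == m then c 0 (rev_ord j) else (i.+1 == j)%:R.

(** * Newton's identities for companion matrices *)

Section Newton.
Variables (F : fieldType) (m : nat) (c : 'rV[F]_m.+1).
Let K := comp_mx c.
Let w t : 'rV[F]_m.+1 := delta_mx 0 ord0 *m K ^+ t.

Let wD t u : w (t + u) = w t *m K ^+ u.
Proof. by rewrite /w -mulmxA mulmxE exprD. Qed.

Let w_small (i : 'I_m.+1) : w i = delta_mx 0 i.
Proof.
case: i => i; elim: i => [|i IHi] lti.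
  by rewrite /w expr0 mulmx1; congr delta_mx; apply: val_inj.
have := wD i 1; rewrite addn1 => ->; rewrite (IHi (ltnW lti)) expr1 -rowE; apply/rowP=> j.
by rewrite !mxE eqxx /= eqSS [X in if X then _ else _]ltn_eqF // eq_sym.
Qed.

Let wE t (i j : 'I_m.+1) : (K ^+ t) i j = w (i + t) 0 j.
Proof. by rewrite wD w_small -rowE mxE. Qed.

Let w_rec t j : w (m.+1 + t) 0 j = \sum_s c 0 (rev_ord s) * w (s + t) 0 j.
Proof.
have wS : w m.+1 = row ord_max K.
  by have := wD (ord_max : 'I_m.+1) 1; rewrite addn1 expr1 w_small -rowE.
rewrite wD wS mxE; apply: eq_bigr => s _.
by rewrite mxE wE mxE eqxx.
Qed.

(** Row j of [K ^+ i] is [w (j + i)], so the trace sums the entries [w (j + i) 0 j]. Those with j +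
    i <= m vanish, as i > 0, and the recurrence [w_rec] expands the others. Exchanging the two sums
    gives the coefficient of each [c 0 t]. *)
Lemma trace_comp_mx_newton i : (0 < i <= m.+1)%N ->
  \tr (comp_mx c ^+ i) =
  \sum_(t < m.+1) c 0 t * (if (t.+1 < i)%N then \tr (comp_mx c ^+ (i - t.+1))
                           else if t.+1 == i then i%:R else 0).
Proof.
case/andP=> i0 im; rewrite -/K {1}/mxtrace.
have w0 t (j : 'I_m.+1) : (t < m.+1)%N -> w t 0 j = (t == j)%:R.
  by move=> lt; rewrite (w_small (Ordinal lt)) mxE eqxx /= eq_sym.
transitivity (\sum_(j < m.+1 | (m.+1 <= j + i)%N)
                 \sum_s c 0 (rev_ord s) * w (s + (j + i - m.+1)) 0 j).
  rewrite [RHS]big_mkcond; apply: eq_bigr => j _; rewrite wE; case: (leqP m.+1 (j + i)) => h.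
    by rewrite -{1}(subnKC h) w_rec.
  by rewrite w0 // gtn_eqF // -[X in (X < _)%N]addn0 ltn_add2l.
rewrite exchange_big (reindex_inj rev_ord_inj); apply: eq_bigr => t _ /=.
rewrite -big_distrr rev_ordK /=; congr (_ * _).
have E (j : 'I_m.+1) : (m.+1 <= j + i)%N -> 
    (m.+1 - t.+1 + (j + i - m.+1) = j + i - t.+1)%N.
  by have := ltn_ord t; lia.
case: ltngtP => [ti|it|ti].
- rewrite /mxtrace [LHS]big_mkcond; apply: eq_bigr => j _; rewrite wE.
  case: (leqP m.+1 (j + i)) => h; first by rewrite E // addnBA // ltnW.
  rewrite w0; last by apply: leq_ltn_trans h; rewrite leq_add2l leq_subr.
  by rewrite gtn_eqF // -[X in (X < _)%N]addn0 ltn_add2l subn_gt0.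
- apply: big1 => j h; rewrite E //.
  have ji : (j + i - t.+1 < j)%N.
    by have := ltn_ord t; lia.
  by rewrite w0 ?ltn_eqF // (ltn_trans ji).
(* Each of the i indices j with j + i >= m + 1 contributes 1. *)
- rewrite (eq_bigr (fun=> 1)); last first.
    by move=> j h; rewrite E // ti addnK w0 // eqxx.
  rewrite (reindex_inj rev_ord_inj) (eq_bigl (fun j : 'I_m.+1 => (j < i)%N)).
    by rewrite -(big_ord_widen _ (fun=> 1) im) sumr_const card_ord.
  by move=> j /=; have := ltn_ord j; lia.
Qed.
End Newton.

(** * Companion matrices with prescribed power traces and determinant *)

Section CompanionCount.
Variables (F : finFieldType) (p : nat).
Hypothesis charFp : p \in [pchar F].

Lemma count_multiples k : (\sum_(t < k) (p %| t.+1) = k %/ p)%N.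
Proof.
have p0 : (0 < p)%N by rewrite prime_gt0 ?(pcharf_prime charFp).
by elim: k => [|k IHk]; rewrite ?big_ord0 ?div0n // big_ord_recr /= IHk divnS // addnC.
Qed.

(** Mixed coordinates on companion matrices. The choice of [P] makes it possible to keep the last
    coefficient, which is the determinant up to sign, as a coordinate. *)
Definition trace_coords (P : pred nat) m (c : 'rV[F]_m) : {ffun 'I_m -> F} :=
  [ffun t : 'I_m => if P t.+1 then \tr (comp_mx c ^+ t.+1) else c 0 t].

(** By Newton, the trace of the power t + 1 is (t + 1) times coefficient t plus terms in earlier
    data, and t + 1 is invertible in F when p does not divide it. The induction recovers all traces
    along with the coefficients, since the identities also involve exponents divisible by p. *)
Lemma trace_coords_inj (P : pred nat) m :
  (forall i, P i -> ~~ (p %| i)%N) -> injective (@trace_coords P m).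
Proof.
case: m => [|m] hP c d cd; first by apply/rowP=> -[].
suff H t : (t < m.+1)%N -> c 0 (inord t) = d 0 (inord t) /\
    \tr (comp_mx c ^+ t.+1) = \tr (comp_mx d ^+ t.+1).
  by apply/rowP=> t; have [] := H t (ltn_ord t); rewrite inord_val.
elim/ltn_ind: t => t IH tm.
pose S (e : 'rV[F]_m.+1) :=
  \sum_(s < m.+1 | (s < t)%N) e 0 s * \tr (comp_mx e ^+ (t - s)).
have newton (e : 'rV[F]_m.+1) :
    \tr (comp_mx e ^+ t.+1) = S e + e 0 (inord t) * t.+1%:R.
  rewrite trace_comp_mx_newton // (bigID (fun s : 'I_m.+1 => (s < t)%N)) /=.
  congr (_ + _); first by apply: eq_bigr => s st; rewrite ltnS st subSS.
  rewrite (bigD1 (inord t)) /= ?inordK ?ltnn // eqxx big1 ?addr0 // => s.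
  rewrite ltnS eqSS => /andP[/negPf-> /negPf st]; case: eqP => E; last by rewrite mulr0.
  by rewrite -E inord_val eqxx in st.
have eqS : S c = S d.
  apply: eq_bigr => s st; have [E _] := IH s st (ltn_trans st tm).
  rewrite inord_val in E; rewrite E; congr (_ * _).
  by rewrite -(subnSK st); have [] // := IH (t - s.+1)%N; lia.
have := congr1 (fun f : {ffun 'I_m.+1 -> F} => f (inord t)) cd.
rewrite !ffunE inordK //; case: ifP => [/hP Pt E|_ E].
  split=> //; move: E; rewrite !newton eqS => /addrI /mulIf; apply.
  by rewrite -(dvdn_pcharf charFp).
by split=> //; rewrite !newton eqS E.
Qed.

(* [trace_coords] is a bijection, so fixing some of its coordinates leaves the others free. *)
Lemma card_trace_coords (P : pred nat) m (J : pred 'I_m) (b : 'I_m -> F) :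
  (forall i, P i -> ~~ (p %| i)%N) ->
  #|[set c : 'rV[F]_m | [forall t, J t ==> (trace_coords P c t == b t)]]|
  = (#|F| ^ \sum_(t < m) ~~ J t)%N.
Proof.
move=> /trace_coords_inj-/(_ m) inj.
pose R := [pred f : {ffun 'I_m -> F} | [forall t, J t ==> (f t == b t)]].
have -> : [set c | [forall t, J t ==> (trace_coords P c t == b t)]] =
    @trace_coords P m @^-1: R by apply/setP=> c; rewrite !inE.
rewrite on_card_preimset; last first.
  by apply: onW_bij; apply: inj_card_bij => //; rewrite card_ffun card_mx card_ord mul1n.
rewrite -(@eq_card _ (family (fun t x => J t ==> (x == b t)))); last first.
  by move=> f; apply/familyP/forallP => H t; exact: H t.
rewrite card_family foldrE big_map big_enum expn_sum /=.
apply: eq_bigr => t _; case: (J t) => /=.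
  by rewrite expn0; exact: card1.
by rewrite expn1; apply: eq_card => x; rewrite inE.
Qed.

Definition trace_set m k (b : nat -> F) (e : F) : {set 'rV[F]_m} :=
  [set c | trace_event p k b (comp_mx c) && (\det (comp_mx c) == e)].

(** Dropping the determinant and the exponents above m leaves floor(m/p) free coordinates, the
    multiples of p up to m. *)
Lemma card_trace_set_le m k b e : (m <= k)%N ->
  (#|trace_set m k b e| <= #|F| ^ (k %/ p))%N.
Proof.
move=> mk; pose P i := ~~ (p %| i)%N.
apply: leq_trans (_ : (#|F| ^ \sum_(t < m) ~~ P t.+1)%N <= _)%N; last first.
  rewrite leq_pexp2l //; first by apply/card_gt0P; exists 0.
  under eq_bigr do rewrite negbK.
  by rewrite count_multiples leq_div2r.
rewrite -(@card_trace_coords P m (fun t => P t.+1) (fun t => b t.+1)) //.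
apply/subset_leq_card/subsetP=> c; rewrite !inE => /andP[/forallP H _].
apply/forallP=> t; apply/implyP=> Pt; rewrite ffunE Pt.
have tk : (t.+1 < k.+1)%N by rewrite ltnS (leq_trans (ltn_ord t)).
by have /implyP/(_ Pt) := H (Ordinal tk).
Qed.

Lemma det_comp_mx m (c : 'rV[F]_m.+1) : \det (comp_mx c) = (-1) ^+ m * c 0 ord_max.
Proof.
rewrite (expand_det_col _ ord0) (bigD1 ord_max) //= big1 ?addr0; last first.
  by move=> i ni; rewrite mxE ifN ?mul0r.
rewrite mxE eqxx mulrC /cofactor /= addn0; congr (_ * _).
  rewrite [X in \det X](_ : _ = 1%:M) ?det1 ?mulr1 //.
  apply/matrixP=> i j; rewrite !mxE /= /bump leqNgt ltn_ord /= add0n add1n eqSS.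
  by rewrite eqSS ltn_eqF ?ltn_ord.
by congr (c 0 _); apply: val_inj; rewrite /= subn1.
Qed.

(** As k < m, the last coordinate is still a coefficient, and the determinant fixes it. Free are the
    floor(k/p) multiples of p up to k and the m - 1 - k coordinates strictly between k and m. *)
Lemma card_trace_set m k b e : (k < m)%N ->
  #|trace_set m k b e| = (#|F| ^ (k %/ p + (m.-1 - k)))%N.
Proof.
case: m => // m; rewrite ltnS => km /=.
pose P i := (i <= k)%N && ~~ (p %| i)%N.
have hP i : P i -> ~~ (p %| i)%N by case/andP.
pose J (t : 'I_m.+1) := P t.+1 || (t == ord_max).
(* The value at [ord_max] inverts the sign in [det_comp_mx]. *)
pose b' (t : 'I_m.+1) := if P t.+1 then b t.+1 else (-1) ^+ m * e.
transitivity (#|F| ^ \sum_(t < m.+1) ~~ J t)%N; last first.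
  congr (_ ^ _)%N; rewrite big_ord_recr /= [in X in (_ + X)%N]/J eqxx orbT addn0.
  transitivity (\sum_(t < m) ~~ P t.+1)%N.
    by apply: eq_bigr => t _; rewrite /J -val_eqE /= ltn_eqF // orbF.
  rewrite -(subnKC km) big_split_ord /= addKn -(count_multiples k); congr (_ + _)%N.
    by apply: eq_bigr => t _; rewrite /P ltn_ord negbK.
  rewrite -[RHS]card_ord -sum1_card; apply: eq_bigr => t _.
  by rewrite /P addnC ltnNge leq_addl.
rewrite -(card_trace_coords J b' hP); congr #|pred_of_set _|.
apply/setP=> c; rewrite !inE det_comp_mx.
have sgnK x : (-1) ^+ m * ((-1) ^+ m * x) = x :> F by rewrite mulrA -expr2 sqrr_sign mul1r.
apply/andP/forallP => [[/forallP H /eqP def_e] t|H].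
  rewrite /J /b' ffunE; case: ifP => [/andP[tk pt]|_] /=.
    by have := H (Ordinal (tk : (t.+1 < k.+1)%N)); rewrite /= pt.
  by apply/implyP=> /eqP->; rewrite -def_e sgnK.
split; last first.
  have := H ord_max; rewrite /J /b' ffunE eqxx orbT /= {1 2}/P ltnNge km /=.
  by move/eqP->; rewrite sgnK.
apply/forallP=> -[[|i] //= ik]; apply/implyP=> pi.
have im : (i < m.+1)%N by lia.
by have := H (Ordinal im); rewrite /J /b' ffunE /P /= pi -ltnS ik.
Qed.
End CompanionCount.

(** * Krylov families and cyclic subspaces *)

Section Krylov.
Variables (F : fieldType).

Definition krylov m n (v : 'rV[F]_n) (M : 'M[F]_n) : 'M[F]_(m, n) :=
  \matrix_(i < m) (v *m M ^+ i).

(** This expresses that the cyclic subspace of v has dimension m without forming it: once v M^m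
    depends on the earlier vectors, so do all later ones. *)
Definition krylov_dim_eq m n (v : 'rV[F]_n) (M : 'M[F]_n) : bool :=
  row_free (krylov m v M) && ~~ row_free (krylov m.+1 v M).

Lemma krylovS m n (v : 'rV[F]_n) (M : 'M[F]_n) :
  (krylov m.+1 v M :=: krylov m v M + v *m M ^+ m)%MS.
Proof.
apply/eqmxP/andP; split; last rewrite addsmx_sub; first apply/row_subP=> i.
  rewrite rowK; have := ltn_ord i; rewrite ltnS leq_eqVlt => /predU1P[->|im].
    exact: addsmxSr.
  apply: submx_trans (addsmxSl _ _).
  by rewrite -[v *m _](rowK (fun i : 'I_m => v *m M ^+ i) (Ordinal im)) row_sub.
rewrite -[v *m _](rowK (fun i : 'I_m.+1 => v *m M ^+ i) ord_max) row_sub andbT.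
apply/row_subP=> i; rewrite rowK.
rewrite -[v *m _](rowK (fun i : 'I_m.+1 => v *m M ^+ i) (widen_ord (leqnSn m) i)).
exact: row_sub.
Qed.

Lemma krylovS_free m n (v : 'rV[F]_n) (M : 'M[F]_n) :
  row_free (krylov m v M) ->
  ~~ row_free (krylov m.+1 v M) = (v *m M ^+ m <= krylov m v M)%MS.
Proof.
move=> fK; rewrite -row_leq_rank krylovS; apply/idP/idP => [|vK].
  apply: contraR => vK; apply: (leq_ltn_trans (eq_leq (esym (eqP fK)))).
  by apply: rank_ltmx; rewrite ltmxE addsmxSl addsmx_sub submx_refl.
rewrite -ltnNge ltnS (leq_trans _ (rank_leq_row (krylov m v M))) //.
by rewrite mxrankS // addsmx_sub submx_refl.
Qed.

Lemma krylov_freeW m n (v : 'rV[F]_n) (M : 'M[F]_n) :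
  row_free (krylov m.+1 v M) -> row_free (krylov m v M).
Proof.
rewrite -!row_leq_rank krylovS => h; rewrite -ltnS (leq_trans h) //.
apply: leq_trans (mxrank_adds_leqif _ _) _.
by rewrite -[X in (_ <= X)%N]addn1 leq_add2l rank_leq_row.
Qed.

(** Freeness is lost exactly once as m grows: the partial sum up to j plus the indicator of freeness
    at j stays 1, and n + 1 vectors in dimension n are never free. *)
Lemma sum_krylov_dim_eq n (v : 'rV[F]_n) (M : 'M[F]_n) :
  (\sum_(m < n.+1) krylov_dim_eq m v M = 1)%N.
Proof.
have E j : (\sum_(m < j) krylov_dim_eq m v M + row_free (krylov j v M) = 1)%N.
  elim: j => [|j IHj]; first by rewrite big_ord0 -row_leq_rank.
  rewrite big_ord_recr /= -IHj -addnA; congr (_ + _)%N; rewrite /krylov_dim_eq.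
  case: (boolP (row_free (krylov j.+1 _ _))) => [/krylov_freeW->//|_].
  by rewrite andbT addn0.
rewrite -[RHS](E n.+1) -row_leq_rank leqNgt ltnS rank_leq_col addn0 //.
Qed.

Lemma mul_comp_mx_row m n (c : 'rV[F]_m) (U : 'M[F]_(m, n)) (i : 'I_m) :
  row i (comp_mx c *m U) = if i.+1 == m then (\row_j c 0 (rev_ord j)) *m U
    else \sum_(j < m | i.+1 == j) row j U.
Proof.
rewrite row_mul; case: ifP => im.
  by congr (_ *m _); apply/rowP=> j; rewrite !mxE im.
rewrite mulmx_sum_row [RHS]big_mkcond; apply: eq_bigr => j _.
by rewrite !mxE im; case: eqP; rewrite (scale1r, scale0r).
Qed.

(** The companion relation says that M sends each row of U to the next one and the last row into the
    span of U. *)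
Lemma krylov_eqP m n (U : 'M[F]_(m.+1, n)) (M : 'M[F]_n) : row_free U ->
  reflect (exists c, U *m M = comp_mx c *m U)
          ((U == krylov m.+1 (row ord0 U) M) &&
           ~~ row_free (krylov m.+2 (row ord0 U) M)).
Proof.
move=> fU; apply: (iffP andP) => [[/eqP defU]|[c Uc]].
  rewrite krylovS_free -defU // => /submxP[d dU].
  exists (\row_j d 0 (rev_ord j)); apply/row_matrixP=> i.
  rewrite mul_comp_mx_row row_mul {1}defU rowK -mulmxA mulmxE -exprSr.
  case: eqP => [->|/eqP im].
    rewrite [LHS]dU; congr (_ *m _).
    by apply/rowP=> j; rewrite !mxE rev_ordK.
  have im' : (i.+1 < m.+1)%N by rewrite ltn_neqAle im ltn_ord.
  by rewrite (big_pred1 (Ordinal im')) // [in RHS]defU rowK.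
have H i (im : (i < m.+1)%N) : row (Ordinal im) U = row ord0 U *m M ^+ i.
  elim: i im => [|i IHi] im.
    by rewrite expr0 mulmx1; congr row; apply: val_inj.
  rewrite exprSr -mulmxE mulmxA -(IHi (ltnW im)) -row_mul Uc mul_comp_mx_row.
  by rewrite ltn_eqF // (big_pred1 (Ordinal im)).
have defU : U = krylov m.+1 (row ord0 U) M.
  by apply/row_matrixP=> -[i im]; rewrite rowK H.
rewrite -defU eqxx krylovS_free -defU //; split=> //.
rewrite exprSr -mulmxE mulmxA -(H _ (ltnSn m)) -row_mul Uc mul_comp_mx_row eqxx.
exact: submxMl.
Qed.

End Krylov.

(** * Double counting of vectors, bases and matrices *)

Section Counting.
Variable F : finFieldType.

Definition units_mx n : {set 'M[F]_n} := [set B | B \in unitmx].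

Lemma sum_nat_bool (T : finType) (A : {pred T}) (P : pred T) :
  (\sum_(x in A) P x)%N = #|[set x in A | P x]|.
Proof. by rewrite -sum1dep_card [RHS]big_mkcondr. Qed.

Lemma card_krylov_generators m n (U : 'M[F]_(m, n)) (M : 'M[F]_n) : row_free U ->
  #|[set v | (U == krylov m v M) && ~~ row_free (krylov m.+1 v M)]| =
  [exists c, U *m M == comp_mx c *m U].
Proof.
case: m U => [|m] U fU.
  (* For m = 0 the only such vector is 0; for m > 0 it can only be the first row of U. *)
  rewrite (_ : [exists c, _] = true); last first.
    by apply/existsP; exists 0; rewrite !flatmx0.
  transitivity #|[set (0 : 'rV[F]_n)]|; last by rewrite cards1.
  congr #|pred_of_set _|; apply/setP=> v.
  rewrite !inE flatmx0 [krylov 0 v M]flatmx0 eqxx krylovS_free ?expr0 ?mulmx1.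
    by rewrite [krylov 0 v M]flatmx0 eqmx0 submx0.
  by rewrite -row_leq_rank.
have -> : [exists c, U *m M == comp_mx c *m U] =
    (U == krylov m.+1 (row ord0 U) M) && ~~ row_free (krylov m.+2 (row ord0 U) M).
  apply/existsP/idP => [[c /eqP Uc]|/(krylov_eqP M fU)[c Uc]]; last by exists c; apply/eqP.
  by apply/(krylov_eqP M fU); exists c.
have v0 v : U = krylov m.+1 v M -> v = row ord0 U.
  by move->; rewrite rowK expr0 mulmx1.
case: (boolP (_ && _)) => h.
  transitivity #|[set row ord0 U]|; last by rewrite cards1.
  congr #|pred_of_set _|; apply/setP=> v.
  by rewrite !inE; apply/andP/eqP => [[/eqP/v0]|->] //; apply/andP; rewrite h.
apply: eq_card0 => v; rewrite !inE; apply: contraNF h => /andP[/eqP defU fS].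
by rewrite -(v0 _ defU) -defU eqxx.
Qed.

Lemma usubmx_unit_free m n (B : 'M[F]_(m + n)) : B \in unitmx -> row_free (usubmx B).
Proof.
move=> Bu; apply/row_freeP; exists (invmx B *m col_mx 1%:M 0).
rewrite mulmxA mul_usub_mx mulmxV // scalar_mx_block block_mxEv col_mxKu.
by rewrite mul_row_col mul1mx mul0mx addr0.
Qed.

(** If g is one invertible completion of U, the others are the products of g with a block matrix
    with rows (1, 0) and (X, Y), where X is arbitrary and Y invertible. *)
Lemma card_unit_completions m n (U : 'M[F]_(m, m + n)) : row_free U ->
  #|[set B in units_mx (m + n) | U == usubmx B]| = (#|F| ^ (n * m) * #|units_mx n|)%N.
Proof.
move=> fU; pose I0 : 'M[F]_(m, m + n) := row_mx 1%:M 0.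
have I0f : I0 *m col_mx U 0 = U by rewrite mul_row_col mul1mx mul0mx addr0.
have [|g gu defU] := @complete_unitmx _ _ _ I0 (col_mx U 0).
  rewrite I0f (eqP fU); apply/esym/eqP; apply/row_freeP.
  by exists (col_mx 1%:M 0); rewrite mul_row_col mul1mx mul0mx addr0.
rewrite I0f in defU.
pose f (XY : 'M[F]_(n, m) * 'M[F]_n) := block_mx 1%:M 0 XY.1 XY.2 *m g.
rewrite -card_mx -cardsT -cardsX -(card_imset _ (f := f)); last first.
  move=> [X Y] [X' Y'] /(can_inj (mulmxK gu)) /eq_block_mx[_ _ /= -> ->] //.
apply: eq_card => B; rewrite inE; apply/andP/imsetP => [[]|[[X Y]]].
  rewrite inE => Bu /eqP UB; pose A := B *m invmx g.
  have uA : usubmx A = I0 by rewrite -mul_usub_mx -UB defU mulmxK.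
  have defA : A = block_mx 1%:M 0 (dlsubmx A) (drsubmx A).
    by rewrite -[A in LHS]vsubmxK uA -[dsubmx A]hsubmxK.
  exists (dlsubmx A, drsubmx A); last by rewrite /f /= -defA mulmxKV.
  rewrite !inE /= unitmxE -[\det _]mul1r -(det1 F m).
  by rewrite -(det_lblock _ (dlsubmx A)) -defA -unitmxE unitmx_mul Bu unitmx_inv.
rewrite !inE => /= Yu ->; split; last by rewrite -mul_usub_mx block_mxEv col_mxKu defU.
by rewrite unitmx_mul gu andbT unitmxE det_lblock det1 mul1r -unitmxE.
Qed.

(* Both sides count the pairs (B, M) with B invertible, M in T and B M B^-1 of the
   block form; on the left B is built from its first m rows, a Krylov family of M. *)
Lemma count_by_krylov_dim m n (T : {set 'M[F]_(m + n)}) :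
  (forall B M, B \in unitmx -> (B *m M *m invmx B \in T) = (M \in T)) ->
  ((\sum_(M in T) \sum_v krylov_dim_eq m v M) * (#|F| ^ (n * m) * #|units_mx n|) =
   #|units_mx (m + n)| *
     #|[set A in T | [exists c, usubmx A == row_mx (comp_mx c) 0]]|)%N.
Proof.
move=> conjT; pose block (A : 'M[F]_(m + n)) := [exists c, usubmx A == row_mx (@comp_mx F m c) 0].
transitivity (\sum_(M in T) \sum_(B in units_mx (m + n)) block (B *m M *m invmx B))%N.
  rewrite big_distrl; apply: eq_bigr => M _ /=; rewrite big_distrl /=.
  (* The constant factor counts the invertible B whose first m rows are the Krylov family of v. *)
  transitivity (\sum_v \sum_(B in units_mx (m + n))
      ((usubmx B == krylov m v M) && ~~ row_free (krylov m.+1 v M)))%N.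
    apply: eq_bigr => v _; rewrite /krylov_dim_eq.
    case: (boolP (row_free (krylov m v M))) => fK /=.
      rewrite -(card_unit_completions fK) -sum_nat_bool mulnC big_distrl /=.
      by apply: eq_bigr => B _; rewrite eq_sym -mulnb mulnC.
    rewrite mul0n big1 // => B; rewrite inE => Bu.
    case: eqP => // E; case/negP: fK; rewrite -E.
    exact: usubmx_unit_free.
  rewrite exchange_big; apply: eq_bigr => B; rewrite inE => Bu /=.
  transitivity [exists c, usubmx B *m M == comp_mx c *m usubmx B]%N.
    rewrite -(card_krylov_generators _ (usubmx_unit_free Bu)).
    by rewrite -(sum_nat_bool predT).
  congr (nat_of_bool _); apply: eq_existsb => c.
  have -> : comp_mx c *m usubmx B = row_mx (comp_mx c) 0 *m B.
    by rewrite -[in RHS](vsubmxK B) mul_row_col mul0mx addr0.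
  rewrite -!mul_usub_mx; apply/eqP/eqP => [->|<-]; first by rewrite mulmxK.
  by rewrite mulmxKV.
(* Conjugation by B permutes T, so the inner sum is the same for every B. *)
rewrite exchange_big -sum_nat_const; apply: eq_bigr => B; rewrite inE => Bu.
rewrite -sum_nat_bool.
have conj_inj : injective (fun M => B *m M *m invmx B).
  by move=> M N /(can_inj (mulmxKV Bu)) /(can_inj (mulKmx Bu)).
rewrite [RHS](reindex_inj conj_inj) /=; apply: eq_bigl => M.
by rewrite conjT.
Qed.
End Counting.

(** * Counting the matrices of SL that satisfy the trace conditions *)

Section Assembly.
Variable F : finFieldType.

(** Left multiplication by diag(d, 1, ..., 1) maps SL bijectively onto the matrices of determinant
    d. *)
Lemma card_units_SL n : #|units_mx F n.+1| = (#|F|.-1 * #|SL_set F n.+1|)%N.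
Proof.
rewrite -sum1_card (partition_big (fun B : 'M[F]_n.+1 => \det B) (fun d => d != 0)) /=; last first.
  by move=> B; rewrite inE unitmxE unitfE.
rewrite -(cardC1 (0 : F)) -sum_nat_const; apply: eq_bigr => d d0.
pose D : 'M[F]_n.+1 := diag_mx (\row_j if j == ord0 then d else 1).
have detD : \det D = d.
  rewrite det_diag (bigD1 ord0) //= big1 ?mulr1 ?mxE ?eqxx // => j j0.
  by rewrite mxE ifN.
have Du : D \in unitmx by rewrite unitmxE unitfE detD.
rewrite sum1dep_card -(card_preimset _ (can_inj (mulKmx Du))).
apply: eq_card => M; rewrite !inE unitmxE det_mulmx detD unitfE.
have -> : (d * \det M == d) = (\det M == 1) by rewrite -{2}[d]mulr1 (inj_eq (mulfI d0)).
by case: (eqVneq (\det M) 1) => [->|]; rewrite ?andbF // mulr1 d0.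
Qed.

Lemma expr_lblock_mx m n (K : 'M[F]_m) (X : 'M[F]_(n, m)) (N : 'M[F]_n) i :
  exists Y, block_mx K 0 X N ^+ i = block_mx (K ^+ i) 0 Y (N ^+ i).
Proof.
elim: i => [|i [Y IHi]]; first by exists 0; rewrite !expr0 -scalar_mx_block.
exists (X *m K ^+ i + N *m Y).
by rewrite !exprS IHi -!mulmxE mulmx_block !mul0mx !mulmx0 !addr0 add0r.
Qed.

Lemma comp_mx_inj m : injective (@comp_mx F m).
Proof.
case: m => [|m] c d cd; first by apply/rowP=> -[].
apply/rowP=> j; have := congr1 (fun A : 'M_m.+1 => A ord_max (rev_ord j)) cd.
by rewrite !mxE eqxx rev_ordK.
Qed.

Lemma expr_conjmx n (B M : 'M[F]_n) i : B \in unitmx ->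
  (B *m M *m invmx B) ^+ i = B *m M ^+ i *m invmx B.
Proof.
move=> Bu; elim: i => [|i IHi]; first by rewrite !expr0 mulmx1 mulmxV.
by rewrite !exprSr IHi -!mulmxE !mulmxA mulmxKV.
Qed.

Variables (p k : nat) (a : nat -> F).
Hypothesis charFp : p \in [pchar F].

Definition SL_trace_set n : {set 'M[F]_n} :=
  [set M in SL_set F n | trace_event p k a M].

Lemma SL_trace_set_conj n (B M : 'M[F]_n) : B \in unitmx ->
  (B *m M *m invmx B \in SL_trace_set n) = (M \in SL_trace_set n).
Proof.
move=> Bu; have trJ i : \tr ((B *m M *m invmx B) ^+ i) = \tr (M ^+ i).
  by rewrite expr_conjmx // mxtrace_mulC mulmxA mulVmx // mul1mx.
rewrite !inE !det_mulmx mulrAC -det_mulmx mulmxV // det1 mul1r.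
by congr (_ && _); apply: eq_forallb => i; rewrite trJ.
Qed.

(** Traces of powers add over the diagonal blocks and determinants multiply, so N only shifts the
    conditions on the companion block. *)
Lemma lblock_SL_trace_set m n (c : 'rV[F]_m) (X : 'M[F]_(n, m)) (N : 'M[F]_n) :
  (block_mx (comp_mx c) 0 X N \in SL_trace_set (m + n)) =
  (N \in units_mx F n) &&
  (c \in trace_set p m k (fun i => a i - \tr (N ^+ i)) (\det N)^-1).
Proof.
rewrite !inE det_lblock unitmxE unitfE andbCA andbC; congr (_ && _).
  apply: eq_forallb => i; have [Y ->] := expr_lblock_mx (comp_mx c) X N i.
  by rewrite mxtrace_block -[in RHS](inj_eq (addIr (\tr (N ^+ i)))) subrK.
have [->|N0] := eqVneq (\det N) 0; first by rewrite mulr0 eq_sym oner_eq0.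
by rewrite -[in RHS](inj_eq (mulIf N0)) mulVf.
Qed.

Lemma card_lblock_SL_trace_set m n :
  #|[set A in SL_trace_set (m + n) | [exists c, usubmx A == row_mx (comp_mx c) 0]]|
  = (#|F| ^ (n * m) * \sum_(N in units_mx F n)
       #|trace_set p m k (fun i => a i - \tr (N ^+ i))%R (\det N)^-1%R|)%N.
Proof.
pose S (N : 'M[F]_n) := trace_set p m k (fun i => a i - \tr (N ^+ i)) (\det N)^-1.
under eq_bigr do rewrite -sum1_card.
rewrite pair_big_dep sum1dep_card -card_mx -cardsT -cardsX.
pose f (x : 'M[F]_(n, m) * ('M[F]_n * 'rV[F]_m)) := block_mx (comp_mx x.2.2) 0 x.1 x.2.1.
rewrite -(card_imset _ (f := f)); last first.
  by move=> [X [N c]] [X' [N' c']] /eq_block_mx[/= /comp_mx_inj-> _ -> ->].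
apply: eq_card => A; rewrite inE; apply/andP/imsetP => [[AT /existsP[c /eqP cA]]|[[X [N c]]]].
  have defA : A = block_mx (comp_mx c) 0 (dlsubmx A) (drsubmx A).
    by rewrite -[A in LHS]vsubmxK cA -[dsubmx A]hsubmxK.
  exists (dlsubmx A, (drsubmx A, c)); last by [].
  by rewrite inE in_setT in_set -(lblock_SL_trace_set _ (dlsubmx A)) -defA.
rewrite inE in_setT in_set -(lblock_SL_trace_set _ X) /f /= => fT ->; split=> //.
by apply/existsP; exists c; rewrite block_mxEv col_mxKu.
Qed.

Definition krylov_count n m :=
  (\sum_(M in SL_trace_set n) \sum_v krylov_dim_eq m v M)%N.

Lemma units_mx_gt0 n : (0 < #|units_mx F n|)%N.
Proof. by apply/card_gt0P; exists 1%:M; rewrite inE unitmx1. Qed.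

Lemma card_field_gt0 : (0 < #|F|)%N.
Proof. by apply/card_gt0P; exists 0. Qed.

(** The power q^(n m), counting completions on one side and lower left blocks on the other,
    cancels. *)
Lemma krylov_countE m n :
  (krylov_count (m + n) m * #|units_mx F n| = #|units_mx F (m + n)| *
   \sum_(N in units_mx F n) #|trace_set p m k (fun i => a i - \tr (N ^+ i))%R (\det N)^-1%R|)%N.
Proof.
have := count_by_krylov_dim (@SL_trace_set_conj (m + n)).
rewrite card_lblock_SL_trace_set => /eqP.
rewrite mulnCA [X in _ == X]mulnCA eqn_pmul2l ?expn_gt0 ?card_field_gt0 //.
by move/eqP.
Qed.

Lemma krylov_count_large n m : (k < m <= n)%N ->
  krylov_count n m = (#|units_mx F n| * #|F| ^ (k %/ p + (m.-1 - k)))%N.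
Proof.
case/andP=> km /subnKC <-; apply/eqP.
rewrite -(eqn_pmul2r (units_mx_gt0 (n - m))) krylov_countE -mulnA; apply/eqP.
congr (_ * _)%N; rewrite mulnC -sum_nat_const; apply: eq_bigr => N _.
by rewrite card_trace_set.
Qed.

Lemma krylov_count_small n m : (m <= n)%N -> (m <= k)%N ->
  (krylov_count n m <= #|units_mx F n| * #|F| ^ (k %/ p))%N.
Proof.
move=> /subnKC <- mk.
rewrite -(leq_pmul2r (units_mx_gt0 (n - m))) krylov_countE -mulnA leq_mul2l.
apply/orP; right; rewrite mulnC -sum_nat_const; apply: leq_sum => N _.
by rewrite card_trace_set_le.
Qed.

Lemma sum_krylov_count n :
  (\sum_(m < n.+1) krylov_count n m = #|SL_trace_set n| * #|F| ^ n)%N.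
Proof.
rewrite exchange_big -sum_nat_const; apply: eq_bigr => M _.
rewrite exchange_big -[in RHS](mul1n n) -card_mx -sum1_card.
by apply: eq_bigr => v _; rewrite sum_krylov_dim_eq.
Qed.

(** E collects the terms m <= k. The terms m > k sum to |SL| q^floor(k/p) (q^(n-k) - 1), and the
    subtracted part is moved to the left to stay within the naturals. *)
Lemma card_SL_trace_set n : (0 < n)%N -> (k <= n)%N ->
  exists2 E, (E <= #|SL_set F n| * ((#|F| - 1) * (k + 1) * #|F| ^ (k %/ p)))%N &
    (#|SL_trace_set n| * #|F| ^ n + #|SL_set F n| * #|F| ^ (k %/ p) =
     #|SL_set F n| * #|F| ^ (k %/ p + (n - k)) + E)%N.
Proof.
move=> n0 kn; exists (\sum_(m < k.+1) krylov_count n m)%N.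
  apply: (@leq_trans (\sum_(m < k.+1) #|units_mx F n| * #|F| ^ (k %/ p))%N).
    apply: leq_sum => m _; have mk := ltn_ord m.
    by rewrite krylov_count_small // (leq_trans _ kn).
  rewrite sum_nat_const card_ord -(prednK n0) card_units_SL subn1 addn1.
  by rewrite leq_eqVlt; apply/orP; left; apply/eqP; ring.
rewrite -sum_krylov_count -(subnKC kn) -addSn big_split_ord /= subnKC //.
rewrite -addnA addnC; congr (_ + _)%N.
(* With m = k + 1 + j, the exponent m - 1 - k is j; the factor q - 1 in |GL| then closes the
   geometric series. *)
rewrite (eq_bigr (fun j : 'I_(n - k) => #|units_mx F n| * #|F| ^ (k %/ p) * #|F| ^ j))%N; last first.
  move=> j _; rewrite krylov_count_large; last by have := ltn_ord j; lia.
  by rewrite -mulnA -expnD /= addKn.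
rewrite -big_distrr /= -(prednK n0) card_units_SL (prednK n0) expnD.
have := predn_exp #|F| (n - k).
have : (0 < #|F| ^ (n - k))%N by rewrite expn_gt0 card_field_gt0.
move: (\sum_(i < n - k) _)%N (#|F| ^ (n - k))%N => S Q Q0 QS.
by rewrite -(prednK Q0) QS; ring.
Qed.

End Assembly.

(** * From the count to the probability *)

Theorem theorem4p9 (F : finFieldType) (p : nat) (n k : nat) (a : nat -> F) :
  prime p -> p \in [pchar F] ->
  (1 <= k)%N -> (k <= n)%N ->
  `| prob_SL_trace n p k a - 1 / (#|F|%:R ^+ (k - k %/ p)%N : rat) |
    <= ((#|F| - 1) * (k + 1) * #|F| ^ (k %/ p))%N%:R / (#|F|%:R ^+ n : rat).
Proof.
move=> pr_p charFp k0 kn.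
have [E leE cardE] := card_SL_trace_set a charFp (leq_trans k0 kn) kn.
have F1 := finRing_gt1 F.
have SL0 : (0 < #|SL_set F n|)%N by apply/card_gt0P; exists 1%:M; rewrite inE det1.
have q0 : (#|F|%:R : rat) != 0 by rewrite pnatr_eq0 -lt0n ltnW.
have s0 : (0 : rat) < #|SL_set F n|%:R by rewrite ltr0n.
rewrite /prob_SL_trace ler_pdivlMr ?exprn_gt0 ?ltr0n 1?ltnW //.
rewrite -[X in _ * X]ger0_norm ?exprn_ge0 ?ler0n // -normrM.
set W := ((#|F| - 1) * (k + 1) * #|F| ^ (k %/ p))%N in leE *.
have -> : (#|SL_trace_set p k a n|%:R / #|SL_set F n|%:R
     - 1 / #|F|%:R ^+ (k - k %/ p)) * #|F|%:R ^+ n =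
     E%:R / #|SL_set F n|%:R - (#|F| ^ (k %/ p))%:R :> rat.
  have kp : (k %/ p <= k)%N by rewrite leq_div.
  (* This splitting turns q^n / q^(k - floor(k/p)) into the main term of [cardE]. *)
  have en : n = (k - k %/ p + (k %/ p + (n - k)))%N by lia.
  rewrite mulrBl div1r [in X in _ - X]en exprD mulKf ?expf_neq0 //.
  have := congr1 (fun x => x%:R : rat) cardE; rewrite !(natrD, natrM) !natrX => H.
  have -> : E%:R = #|SL_trace_set p k a n|%:R * #|F|%:R ^+ n
      + #|SL_set F n|%:R * #|F|%:R ^+ (k %/ p)
      - #|SL_set F n|%:R * #|F|%:R ^+ (k %/ p + (n - k)) :> rat.
    by rewrite H addrC addKr.
  by field; rewrite lt0r_neq0.
(* Both terms of the difference lie between 0 and W, so its absolute value is at most W. *)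
have E0 : 0 <= E%:R / #|SL_set F n|%:R :> rat by rewrite divr_ge0 ?ler0n.
have EW : E%:R / #|SL_set F n|%:R <= W%:R :> rat.
  by rewrite ler_pdivrMr // mulrC -natrM ler_nat.
have qW : (#|F| ^ (k %/ p))%:R <= W%:R :> rat.
  by rewrite ler_nat leq_pmull // muln_gt0 subn_gt0 F1 addn1.
have q_ge0 : 0 <= (#|F| ^ (k %/ p))%:R :> rat by rewrite ler0n.
by rewrite ler_norml; apply/andP; split; lra.
Qed.
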